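(* Let $A_1\in\mathbb{R}^{n\times n}$ be a strongly Schur-Horn continuous symmetric matrix whose spectrum window satisfies $\mu(\omega(A_1))>0$, where $\mu$ is the Lebesgue measure on $\mathbb{R}$. Then for any $d_2\in\omega(A_1)^{\circ}$ (the interior of $\omega(A_1)$), the matrix $A=\begin{bmatrix}A_1&0\\0&d_2\end{bmatrix}$ is strongly Schur-Horn continuous.
   Context: The spectrum window of a symmetric matrix $A$ is the closed interval $\omega(A)=[\lambda_{\min}(A),\lambda_{\max}(A)]$, where $\lambda_{\min},\lambda_{\max}$ are the minimum and maximum eigenvalues. $\|\cdot\|_{\mathrm F}$ is the Frobenius norm; $\mathrm{diag}(M)$ is the vector of diagonal entries of a matrix $M$. Big-$O$ convention: $\varepsilon>0$ is the asymptotic variable tending to zero; perturbed quantities are families indexed by sufficiently small $\varepsilon>0$; all other data (matrix dimension, the matrix $A$) are constants. Definition (strong Schur-Horn continuity). Suppose $A\in\mathbb{R}^{n\times n}$ is a symmetric matrix with an eigendecomposition $A=Q\Lambda Q^\top$, where $Q$ is the orthonormal eigenvector matrix and $\Lambda$ is the diagonal eigenvalue matrix. $A$ is strongly Schur-Horn continuous if, for any perturbed eigenvalues $\widetilde\Lambda$ (a real diagonal matrix) satisfying $\mathrm{tr}(\widetilde\Lambda)=\mathrm{tr}(\Lambda)$ and $\|\widetilde\Lambda-\Lambda\|_{\mathrm F}=O(\varepsilon)$ for $\varepsilon>0$ sufficiently small, there exists a symmetric matrix $\widetilde B=G_2QG_1\widetilde\Lambda G_1^\top Q^\top G_2^\top$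 such that (1) $\mathrm{diag}(\widetilde B)=\mathrm{diag}(A)$; (2) $G_1$ and $G_2$ are orthogonal matrices; (3) $\|G_i-I\|_{\mathrm F}=O(\varepsilon^{1/2})$ for $i=1,2$. *)

(* Defs.v *)
From mathcomp Require Import all_boot all_order all_algebra.
From mathcomp Require Import all_classical all_reals all_analysis.

Set Implicit Arguments.
Unset Strict Implicit.
Unset Printing Implicit Defensive.

Import Order.TTheory GRing.Theory Num.Theory.
Import numFieldNormedType.Exports.

Local Open Scope classical_set_scope.
Local Open Scope ring_scope.

(* The library norm [`|M|] on matrices is the max norm. *)
Definition frobenius_norm (R : realType) (m n : nat) (M : 'M[R]_(m, n)) : R :=
  Num.sqrt (\sum_i \sum_j M i j ^+ 2).

Definition diag_of (R : realType) (n : nat) (M : 'M[R]_n) : 'rV[R]_n :=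
  \row_i M i i.

Definition orthogonal_mx (R : realType) (n : nat) (Q : 'M[R]_n) : Prop :=
  Q *m Q^T = 1%:M.

(* The eigenvalues form a finite set, which is nonempty if the matrix is
   symmetric and n > 0; inf and sup are then its minimum and maximum.  For
   n = 0 both are 0 by the convention inf set0 = sup set0 = 0. *)
Definition lambda_min (R : realType) (n : nat) (A : 'M[R]_n) : R :=
  inf [set a : R | eigenvalue A a].

Definition lambda_max (R : realType) (n : nat) (A : 'M[R]_n) : R :=
  sup [set a : R | eigenvalue A a].

Definition spectrum_window (R : realType) (n : nat) (A : 'M[R]_n) : set R :=
  [set` `[lambda_min A, lambda_max A]].

Definition eigendecomposition (R : realType) (n : nat)
    (A Q L : 'M[R]_n) : Prop :=
  [/\ orthogonal_mx Q, is_diag_mx L & A = Q *m L *m Q^T].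

(* Perturbed quantities are families indexed by e : R, of which only the values
   at sufficiently small e > 0 matter (the filter 0^'+). *)
Definition admissible_perturbation (R : realType) (n : nat)
    (L : 'M[R]_n) (Lt : R -> 'M[R]_n) : Prop :=
  [/\ \forall e \near 0^'+, is_diag_mx (Lt e),
      \forall e \near 0^'+, \tr (Lt e) = \tr L
    & (fun e : R => frobenius_norm (Lt e - L)) =O_ (0^'+) (fun e : R => e)].

(* Strong Schur-Horn continuity of A relative to a fixed A = Q L Q^T. *)
Definition strongly_schur_horn_continuous_wrt (R : realType) (n : nat)
    (A Q L : 'M[R]_n) : Prop :=
  forall Lt : R -> 'M[R]_n, admissible_perturbation L Lt ->
  exists Bt G1 G2 : R -> 'M[R]_n,
    [/\ \forall e \near 0^'+,
          [/\ (Bt e)^T = Bt e,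
              Bt e = G2 e *m Q *m G1 e *m Lt e *m (G1 e)^T *m Q^T *m (G2 e)^T,
              diag_of (Bt e) = diag_of A,
              orthogonal_mx (G1 e)
            & orthogonal_mx (G2 e)],
        (fun e : R => frobenius_norm (G1 e - 1%:M))
          =O_ (0^'+) (fun e : R => Num.sqrt e)
      & (fun e : R => frobenius_norm (G2 e - 1%:M))
          =O_ (0^'+) (fun e : R => Num.sqrt e)].

(* The eigendecomposition is fixed before the perturbation.  When A has a
   multiple eigenvalue the property may depend on which one is taken; A is
   required to have one that works for every perturbation. *)
Definition strongly_schur_horn_continuous (R : realType) (n : nat)
    (A : 'M[R]_n) : Prop :=
  A^T = A /\
  exists Q L : 'M[R]_n,
    eigendecomposition A Q L /\ strongly_schur_horn_continuous_wrt A Q L.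

(* Main.v *)
(* Write the perturbed spectrum as (D, x) with x = d2 + delta, delta = O(eps).
   Since d2 lies strictly between two eigenvalues of A1, one of them, D_kk, lies
   on the side of d2 opposite to x, at a distance bounded below.  Rotating in the
   plane (k, n+1) by an angle with sin^2 = delta / (x - D_kk) = O(eps) sets the last
   diagonal entry to d2 and moves delta into D_kk; the resulting upper left
   block is diagonal and has the trace of A1, so strong Schur-Horn continuity of
   A1 applies to it.  Composing G1 with this O(eps^{1/2}) rotation suffices. *)
Require Import Defs.
From mathcomp Require Import all_boot all_order all_algebra.
From mathcomp Require Import all_classical all_reals all_analysis.
From mathcomp Require Import ring lra.
Import Order.TTheory GRing.Theory Num.Theory.
Import numFieldNormedType.Exports.
Local Open Scope classical_set_scope.
Local Open Scope ring_scope.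

(** Squaring removes the roots from both sides: squared Frobenius norms are traces and add over
    blocks, and [Num.sqrt e] becomes [e] for positive [e]. *)
Lemma bigO_sqrP (T : Type) (R : realType) (F : filter_on T) (f g : T -> R) :
  f =O_F g <-> exists2 K, 0 < K & \forall x \near F, f x ^+ 2 <= K * g x ^+ 2.
Proof.
rewrite eqO_exP; split=> -[K K0 fg].
  exists (K ^+ 2); first exact: exprn_gt0.
  near=> x.
  rewrite -[f x ^+ 2]real_normK ?num_real// -[g x ^+ 2]real_normK ?num_real//.
  rewrite -exprMn lerXn2r ?nnegrE ?mulr_ge0 ?(ltW K0)//; near: x; exact: fg.
exists (Num.sqrt K); first by rewrite sqrtr_gt0.
near=> x; rewrite -!sqrtr_sqr -sqrtrM ?(ltW K0)// ler_wsqrtr//.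
by near: x; exact: fg.
Unshelve. all: by end_near. Qed.

(** * The squared Frobenius norm *)

Section Frobenius.
Context {R : realType}.
Implicit Types m n : nat.

Lemma frobenius_norm_sqr m n (M : 'M[R]_(m, n)) :
  frobenius_norm M ^+ 2 = \sum_i \sum_j M i j ^+ 2.
Proof.
rewrite sqr_sqrtr// sumr_ge0// => i _.
by rewrite sumr_ge0// => j _; rewrite sqr_ge0.
Qed.

Lemma frobenius_norm_sqr_trace m n (M : 'M[R]_(m, n)) :
  frobenius_norm M ^+ 2 = \tr (M *m M^T).
Proof.
rewrite frobenius_norm_sqr; apply: eq_bigr => i _; rewrite mxE.
by apply: eq_bigr => j _; rewrite mxE.
Qed.

(** Squared substitute for the triangle inequality; entrywise it is [(a - b) ^+ 2 >= 0]. *)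
Lemma frobenius_norm_sqrD m n (A B : 'M[R]_(m, n)) :
  frobenius_norm (A + B) ^+ 2
    <= 2 * (frobenius_norm A ^+ 2 + frobenius_norm B ^+ 2).
Proof.
rewrite !frobenius_norm_sqr -big_split mulr_sumr; apply: ler_sum => i _ /=.
rewrite -big_split mulr_sumr; apply: ler_sum => j _ /=; rewrite mxE.
by have := sqr_ge0 (A i j - B i j); lra.
Qed.

Lemma frobenius_norm_sqrZ m n a (A : 'M[R]_(m, n)) :
  frobenius_norm (a *: A) ^+ 2 = a ^+ 2 * frobenius_norm A ^+ 2.
Proof.
rewrite !frobenius_norm_sqr mulr_sumr; apply: eq_bigr => i _.
by rewrite mulr_sumr; apply: eq_bigr => j _; rewrite mxE exprMn.
Qed.

Lemma frobenius_norm_sqr0 m n : frobenius_norm (0 : 'M[R]_(m, n)) ^+ 2 = 0.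
Proof. by rewrite -(scale0r 0) frobenius_norm_sqrZ expr0n mul0r. Qed.

Lemma frobenius_norm_sqr1 n : frobenius_norm (1%:M : 'M[R]_n) ^+ 2 = n%:R.
Proof. by rewrite frobenius_norm_sqr_trace trmx1 mulmx1 mxtrace1. Qed.

Lemma mxtrace_delta n (i : 'I_n) : \tr (delta_mx i i : 'M[R]_n) = 1.
Proof.
by rewrite -(mul_delta_mx (0 : 'I_1)) mxtrace_mulC mul_delta_mx trace_mx11 mxE.
Qed.

Lemma frobenius_norm_sqr_delta m n (i : 'I_m) (j : 'I_n) :
  frobenius_norm (delta_mx i j : 'M[R]_(m, n)) ^+ 2 = 1.
Proof.
by rewrite frobenius_norm_sqr_trace trmx_delta mul_delta_mx mxtrace_delta.
Qed.

Lemma frobenius_norm_sqr_block m1 m2 n1 n2 (A : 'M[R]_(m1, n1))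
    (B : 'M[R]_(m1, n2)) (C : 'M[R]_(m2, n1)) (D : 'M[R]_(m2, n2)) :
  frobenius_norm (block_mx A B C D) ^+ 2 =
  frobenius_norm A ^+ 2 + frobenius_norm B ^+ 2
    + (frobenius_norm C ^+ 2 + frobenius_norm D ^+ 2).
Proof.
rewrite frobenius_norm_sqr_trace tr_block_mx mulmx_block mxtrace_block.
by rewrite !mxtraceD -!frobenius_norm_sqr_trace.
Qed.

Lemma frobenius_norm_sqr_mulmx_orthogonal m n (A : 'M[R]_(m, n)) (Q : 'M[R]_n) :
  orthogonal_mx Q -> frobenius_norm (A *m Q) ^+ 2 = frobenius_norm A ^+ 2.
Proof.
move=> QQ; rewrite !frobenius_norm_sqr_trace trmx_mul mulmxA -(mulmxA A).
by rewrite QQ mulmx1.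
Qed.

Lemma entry_le_frobenius_norm m n (A : 'M[R]_(m, n)) i j :
  `|A i j| <= frobenius_norm A.
Proof.
rewrite -ler_sqr ?nnegrE ?sqrtr_ge0 ?normr_ge0// real_normK ?num_real//.
rewrite frobenius_norm_sqr (bigD1 i)//= (bigD1 j)//= -addrA lerDl addr_ge0//.
  by rewrite sumr_ge0// => k _; rewrite sqr_ge0.
by rewrite sumr_ge0// => l _; rewrite sumr_ge0// => k _; rewrite sqr_ge0.
Qed.

End Frobenius.

Section DiagonalDelta.
Context {R : realType}.

Lemma mul_is_diag_delta m n (D : 'M[R]_m) (k : 'I_m) (j : 'I_n) :
  is_diag_mx D -> D *m delta_mx k j = D k k *: delta_mx k j.
Proof.
case/diag_mxP=> d ->; apply/matrixP=> i l; rewrite mul_diag_mx !mxE eqxx mulr1n.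
by case: eqP => [->|]; rewrite ?mulr0.
Qed.

Lemma mul_delta_is_diag m n (D : 'M[R]_n) (i : 'I_m) (k : 'I_n) :
  is_diag_mx D -> delta_mx i k *m D = D k k *: delta_mx i k.
Proof.
case/diag_mxP=> d ->; apply/matrixP=> l j; rewrite mul_mx_diag !mxE eqxx mulr1n.
by rewrite mulrC; case: (j =P k) => [->|]; rewrite ?andbF ?mulr0.
Qed.

End DiagonalDelta.

(** * Rotations in the plane of coordinate [k] and the last one *)

Section PlaneRotation.
Context {R : realType} {n : nat}.
Implicit Types (k : 'I_n) (c s x : R) (D : 'M[R]_n).

(** A Givens rotation with cosine [c] and sine [s]; the relation between [c] and [s] is left to the
    lemmas. *)
Definition plane_rotation k c s : 'M[R]_(n + 1) :=
  block_mx (1%:M + (c - 1) *: delta_mx k k) (s *: delta_mx k 0)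
           (- s *: delta_mx 0 k) c%:M.

Lemma plane_rotation_orthogonal k c s :
  c ^+ 2 + s ^+ 2 = 1 -> orthogonal_mx (plane_rotation k c s).
Proof.
move=> cs1; have c2 : c ^+ 2 = 1 - s ^+ 2 by rewrite -cs1 addrK.
rewrite /orthogonal_mx tr_block_mx mulmx_block.
rewrite ![(_ + _)^T]raddfD /= !linearZ /= !trmx_delta !tr_scalar_mx.
rewrite !mulmxDl !mulmxDr -?scalemxAl -?scalemxAr ?mulmx1 ?mul1mx.
rewrite ?mul_scalar_mx ?mul_mx_scalar !mul_delta_mx scalar_mx_block.
congr block_mx; apply/matrixP=> i j; rewrite ?ord1 !mxE ?eqxx /=; ring: c2.
Qed.

(** Only the diagonal blocks are recorded: the off-diagonal ones may be nonzero, but a later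
    block-diagonal conjugation keeps them off the diagonal. *)
Lemma plane_rotation_conj k c s D x :
  is_diag_mx D -> c ^+ 2 + s ^+ 2 = 1 ->
  let E := plane_rotation k c s *m block_mx D 0 0 x%:M
             *m (plane_rotation k c s)^T in
  ulsubmx E = D + (s ^+ 2 * (x - D k k)) *: delta_mx k k /\
  drsubmx E = (x - s ^+ 2 * (x - D k k))%:M.
Proof.
move=> Dd cs1; have c2 : c ^+ 2 = 1 - s ^+ 2 by rewrite -cs1 addrK.
rewrite tr_block_mx !mulmx_block /= block_mxKul block_mxKdr.
rewrite ![(_ + _)^T]raddfD /= ![(_ *: _)^T]linearZ /= !trmx_delta !tr_scalar_mx.
rewrite !mulmx0 ?addr0 ?add0r.
rewrite !mulmxDl !mulmxDr -?scalemxAl -?scalemxAr ?mulmx1 ?mul1mx.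
rewrite ?mul_scalar_mx ?mul_mx_scalar.
rewrite !mul_delta_is_diag// mul_is_diag_delta// -!scalemxAl !mul_delta_mx.
split; apply/matrixP=> i j; rewrite ?ord1 !mxE ?eqxx /=; ring: c2.
Qed.

(** The left side equals [2 * ((c - 1) ^+ 2 + s ^+ 2) = 4 * (1 - c)], and [1 - c <= 1 - c ^+ 2]
    because [0 <= c <= 1]. *)
Lemma frobenius_norm_sqr_plane_rotation k c s :
  0 <= c -> c ^+ 2 + s ^+ 2 = 1 ->
  frobenius_norm (plane_rotation k c s - 1%:M) ^+ 2 <= 4 * s ^+ 2.
Proof.
move=> c0 cs1.
have -> : plane_rotation k c s - 1%:M =
    block_mx ((c - 1) *: delta_mx k k) (s *: delta_mx k 0)
             (- s *: delta_mx 0 k) ((c - 1) *: delta_mx 0 0).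
  rewrite scalar_mx_block opp_block_mx add_block_mx !oppr0 !addr0 addrAC.
  rewrite subrr add0r.
  congr block_mx; apply/matrixP=> i j; rewrite !ord1 !mxE !eqxx /=; ring.
rewrite frobenius_norm_sqr_block !frobenius_norm_sqrZ !frobenius_norm_sqr_delta.
have c1 : c <= 1 by nra.
by nra.
Qed.

End PlaneRotation.

Section Orthogonal.
Context {R : realType} {n : nat}.
Implicit Types P Q H : 'M[R]_n.

Lemma orthogonal_mxM P Q :
  orthogonal_mx P -> orthogonal_mx Q -> orthogonal_mx (P *m Q).
Proof.
rewrite /orthogonal_mx => PP QQ.
by rewrite trmx_mul mulmxA -(mulmxA P) QQ mulmx1.
Qed.

Lemma orthogonal_mx_block1 m H :
  orthogonal_mx H -> orthogonal_mx (block_mx H 0 0 1%:M : 'M[R]_(n + m)).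
Proof.
move=> HH; rewrite /orthogonal_mx tr_block_mx mulmx_block !trmx0 trmx1.
by rewrite !mulmx0 !mul0mx !mulmx1 !addr0 add0r HH -scalar_mx_block.
Qed.

Lemma frobenius_norm_sqr_block1_sub1 m H :
  frobenius_norm ((block_mx H 0 0 1%:M : 'M[R]_(n + m)) - 1%:M) ^+ 2 =
  frobenius_norm (H - 1%:M) ^+ 2.
Proof.
rewrite scalar_mx_block opp_block_mx add_block_mx !oppr0 !addr0 subrr.
rewrite frobenius_norm_sqr_block.
by rewrite !frobenius_norm_sqr0 !addr0.
Qed.

End Orthogonal.

Lemma diag_of_block (R : realType) m n (A : 'M[R]_m) B C (D : 'M[R]_n) :
  diag_of (block_mx A B C D) = row_mx (diag_of A) (diag_of D).
Proof.
apply/rowP=> i; case: (split_ordP i) => j ->.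
  by rewrite row_mxEl [LHS]mxE [RHS]mxE block_mxEul.
by rewrite row_mxEr [LHS]mxE [RHS]mxE block_mxEdr.
Qed.

Lemma is_diag_mx_tr (R : realType) n (D : 'M[R]_n) : is_diag_mx D -> D^T = D.
Proof. by case/diag_mxP=> d ->; rewrite tr_diag_mx. Qed.

(** * Eigenvalues and the spectrum window *)

Section Spectrum.
Context {R : realType} {n : nat}.
Implicit Types (A Q L : 'M[R]_n) (a d : R).

(** If [v] is a row eigenvector of [A], then [v *m Q] is one of [L]; any nonzero coordinate of it
    singles out [k]. *)
Lemma eigenvalue_diag_entry A Q L a :
  eigendecomposition A Q L -> eigenvalue A a -> exists k, L k k = a.
Proof.
move=> [QQ /diag_mxP[l ->] ->] /eigenvalueP[v vA v0].
have QtQ := mulmx1C QQ.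
have wL : v *m Q *m diag_mx l = a *: (v *m Q).
  by rewrite scalemxAl -vA !mulmxA -[RHS]mulmxA QtQ mulmx1.
have /rV0Pn[k wk] : v *m Q != 0.
  by apply: contraNneq v0 => w0; rewrite -[v]mulmx1 -QQ mulmxA w0 mul0mx.
exists k; have -> : diag_mx l k k = l 0 k by rewrite mxE eqxx mulr1n.
apply: (mulfI wk).
by move/rowP/(_ k): wL; rewrite mul_mx_diag [LHS]mxE [RHS]mxE [RHS]mulrC.
Qed.

Lemma window_interior_straddle A Q L d :
  eigendecomposition A Q L -> (spectrum_window A)° d ->
  exists i j, L i i < d < L j j.
Proof.
move=> AQL; rewrite /spectrum_window interior_itv_bnd /=.
rewrite in_itv /= => /andP[ld du].
(* With no eigenvalue, both bounds would default to 0, giving [0 < d < 0]. *)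
have ev0 : [set a : R | eigenvalue A a] !=set0.
  apply/set0P/eqP => ev0; move: ld du; rewrite /lambda_min /lambda_max ev0.
  by rewrite inf0 sup0 => /lt_trans h /h; rewrite ltxx.
have [a /(eigenvalue_diag_entry _ _ _ _ AQL)[i <-] id] := inf_lt ev0 ld.
have [b /(eigenvalue_diag_entry _ _ _ _ AQL)[j <-] dj] := sup_gt ev0 du.
by exists i, j; rewrite id.
Qed.

End Spectrum.

(** Used with [x] the defect [delta] and [y] the denominator of the squared sine: [y] shares the
    sign of [x] and stays at distance [g] from 0. The negative case follows by negating both. *)
Lemma signed_ratio_bound (R : realFieldType) (x y g : R) : 0 < g ->
    (0 <= x -> g <= y) -> (x < 0 -> y <= - g) ->
  [/\ x / y * y = x, 0 <= x / y & x / y <= `|x| / g].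
Proof.
move=> g0 px nx.
have nonneg (u v : R) : 0 <= u -> g <= v ->
    [/\ u / v * v = u, 0 <= u / v & u / v <= `|u| / g].
  move=> u0 gv; have v0 := lt_le_trans g0 gv.
  rewrite divfK ?gt_eqF// divr_ge0 ?(ltW v0)// ger0_norm// ler_wpM2l//.
  by rewrite lef_pV2 ?posrE.
have [x0|x0] := leP 0 x; first by apply: nonneg => //; exact: px.
have [||xy r0 rg] := nonneg (- x) (- y).
- by rewrite oppr_ge0 ltW.
- by rewrite lerNr nx.
move: xy r0 rg; rewrite invrN mulrNN normrN => xy r0 rg; split=> //.
by apply: oppr_inj; rewrite -mulrN.
Qed.

Theorem lemma3p8 (R : realType) (n : nat) (A1 : 'M[R]_n)
    (hsym : A1^T = A1)
    (hA1 : strongly_schur_horn_continuous A1)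
    (hwin : (0 < lebesgue_measure (spectrum_window A1))%E)
    (d2 : R) (hd2 : (spectrum_window A1)° d2) :
  strongly_schur_horn_continuous (block_mx A1 0 0 (d2%:M : 'M[R]_1)).
Proof.
have [_ [Q [L [AQL schurA1]]]] := hA1.
have [i [j /andP[id dj]]] := window_interior_straddle _ _ _ _ AQL hd2.
split; first by rewrite tr_block_mx !trmx0 tr_scalar_mx hsym.
exists (block_mx Q 0 0 1%:M), (block_mx L 0 0 d2%:M).
have [QQ Ldiag A1E] := AQL.
split.
  split; first exact: orthogonal_mx_block1.
    by rewrite is_diag_block_mx// !eqxx Ldiag scalar_mx_is_diag.
  rewrite tr_block_mx !mulmx_block !trmx0 trmx1.
  by rewrite !(mulmx0, mul0mx, mulmx1, mul1mx, addr0, add0r) A1E.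
move=> Lt [Lt_diag Lt_tr /eqO_exP[/= K K0 Lt_O]].
pose D e : 'M[R]_n := ulsubmx (Lt e).
pose x e : R := drsubmx (Lt e) 0 0.
pose delta e := x e - d2.
(* Since [L i i < d2 < L j j], this choice gives [x e - D e (k e) (k e)] the sign of [delta e]. The
   index may jump with [e], as no continuity in [e] is required. *)
pose k e := if 0 <= delta e then i else j.
(* The squared sine of the rotation angle. *)
pose t e := delta e / (x e - D e (k e) (k e)).
(* The upper left block after the rotation, to be fed to the hypothesis on [A1]. *)
pose M e : 'M[R]_n := D e + delta e *: delta_mx (k e) (k e).
have e_gt0 : \forall e \near (0 : R)^'+, 0 < e by exact: nbhs_right_gt.
have LtE : \forall e \near 0^'+,
    Lt e = block_mx (D e) 0 0 (x e)%:M /\ is_diag_mx (D e).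
  near=> e; have : is_diag_mx (Lt e) by near: e.
  rewrite -[Lt e]submxK is_diag_block_mx// => /and4P[/eqP ur0 /eqP dl0 Dd _].
  by split=> //; rewrite ur0 dl0 [drsubmx (Lt e)]mx11_scalar.
have Lt_sqr : \forall e \near 0^'+,
    frobenius_norm (D e - L) ^+ 2 + delta e ^+ 2 <= (K * e) ^+ 2.
  near=> e; have e0 : 0 < e by near: e.
  have [//|LtDx _] := near LtE e.
  have : frobenius_norm (Lt e - block_mx L 0 0 d2%:M) ^+ 2 <= (K * e) ^+ 2.
    rewrite lerXn2r ?nnegrE ?sqrtr_ge0 ?mulr_ge0 ?(ltW K0) ?(ltW e0)//.
    rewrite -[leLHS]ger0_norm ?sqrtr_ge0// -[e in leRHS]gtr0_norm//.
    by near: e.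
  rewrite LtDx opp_block_mx add_block_mx !oppr0 !addr0.
  have -> : (x e)%:M - d2%:M = delta e *: 1%:M :> 'M[R]_1.
    by rewrite scalemx1 raddfB.
  rewrite frobenius_norm_sqr_block !frobenius_norm_sqr0 addr0 add0r.
  by rewrite frobenius_norm_sqrZ frobenius_norm_sqr1 mulr1.
have entry_le l : \forall e \near 0^'+,
    `|D e l l - L l l| <= K * e /\ `|delta e| <= K * e.
  near=> e; have e0 : 0 < e by near: e.
  have Ke0 : 0 <= K * e by rewrite mulr_ge0 ?ltW.
  have /(_ _)/wrap[//|sqr_le] := near Lt_sqr e.
  split; rewrite -ler_sqr ?nnegrE ?normr_ge0//; apply: le_trans sqr_le.
    apply: le_trans (_ : frobenius_norm (D e - L) ^+ 2 <= _).
      rewrite lerXn2r ?nnegrE ?sqrtr_ge0 ?normr_ge0//.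
      by have := entry_le_frobenius_norm _ _ (D e - L) l l; rewrite !mxE.
    by rewrite lerDl sqr_ge0.
  by rewrite real_normK ?num_real// lerDr sqr_ge0.
pose gap := Num.min (d2 - L i i) (L j j - d2).
have gap0 : 0 < gap by rewrite lt_min !subr_gt0 id dj.
have t_spec : \forall e \near 0^'+,
    [/\ t e * (x e - D e (k e) (k e)) = delta e, 0 <= t e,
        t e <= K * e / (gap / 2) & t e <= 1].
  near=> e; have e0 : 0 < e by near: e.
  (* The drift of the chosen entry of [D e] then costs at most [gap / 4], so the denominator keeps
     absolute value at least [gap / 2]; it also yields [t e <= 1], so that [1 - t e] is a squared
     cosine. *)
  have small : K * e <= gap / 4.
    rewrite mulrC -ler_pdivlMr//; apply: ltW; near: e; apply: nbhs_right_lt.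
    by rewrite !divr_gt0.
  have [//|Di dle] := near (entry_le i) e.
  have [//|Dj _] := near (entry_le j) e.
  have gap_i : gap <= d2 - L i i by rewrite ge_min lexx.
  have gap_j : gap <= L j j - d2 by rewrite ge_min lexx orbT.
  have [||| ratioE ratio_ge0 ratio_le] :=
    @signed_ratio_bound R (delta e) (x e - D e (k e) (k e)) (gap / 2).
  - by rewrite divr_gt0.
  - move=> d0; rewrite /k d0.
    by move: Di d0; rewrite /delta ler_norml => /andP[]; lra.
  - move=> d0; rewrite /k ifN -?ltNge//.
    by move: Dj d0; rewrite /delta ler_norml => /andP[]; lra.
  have tK : t e <= K * e / (gap / 2).
    by apply: le_trans ratio_le _; rewrite ler_wpM2r// invr_ge0 divr_ge0 ?ltW.
  split=> //; apply: le_trans tK _; rewrite ler_pdivrMr ?divr_gt0// mul1r; lra.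
have admM : admissible_perturbation L M.
  split.
  - near=> e; have [//|_ /is_diag_mxP Dd] := near LtE e.
    apply/is_diag_mxP => a b ab; rewrite /M mxE Dd// add0r !mxE.
    case: (a =P k e) => [ak|_]; case: (b =P k e) => [bk|_]; rewrite ?mulr0//.
    by rewrite ak bk eqxx in ab.
  - near=> e; have [//|LtDx _] := near LtE e.
    have : \tr (Lt e) = \tr (block_mx L 0 0 (d2%:M : 'M[R]_1)) by near: e.
    rewrite LtDx !mxtrace_block !mxtrace_scalar !mulr1n => trE.
    by rewrite mxtraceD mxtraceZ mxtrace_delta mulr1 /delta addrA trE addrK.
  (* The factor 2 comes from [frobenius_norm_sqrD], and [K ^+ 2] from [Lt_sqr]. *)
  - apply/bigO_sqrP; exists (2 * K ^+ 2); first by rewrite mulr_gt0 ?exprn_gt0.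
    near=> e; rewrite /M addrAC.
    apply: le_trans (frobenius_norm_sqrD _ _ _ _) _.
    rewrite frobenius_norm_sqrZ frobenius_norm_sqr_delta mulr1.
    by rewrite -mulrA -exprMn ler_pM2l//; near: e.
have [Bt [H1 [H2 [BtE H1_O H2_O]]]] := schurA1 M admM.
pose rot e := plane_rotation (k e) (Num.sqrt (1 - t e)) (Num.sqrt (t e)).
pose G1 e := block_mx (H1 e) 0 0 1%:M *m rot e.
pose G2 e : 'M[R]_(n + 1) := block_mx (H2 e) 0 0 1%:M.
have cs1 : \forall e \near 0^'+,
    Num.sqrt (1 - t e) ^+ 2 + Num.sqrt (t e) ^+ 2 = 1.
  near=> e; have [//|_ t0 _ t1] := near t_spec e.
  by rewrite !sqr_sqrtr ?subr_ge0// subrK.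
pose Bt' e := G2 e *m block_mx Q 0 0 1%:M *m G1 e *m Lt e *m (G1 e)^T
   *m (block_mx Q 0 0 1%:M)^T *m (G2 e)^T.
exists Bt', G1, G2; split.
- near=> e; have [//|LtDx Dd] := near LtE e.
  have [//|_ BtQ Bt_diag H1o H2o] := near BtE e.
  have [//|tE t0 _ _] := near t_spec e.
  have cse : Num.sqrt (1 - t e) ^+ 2 + Num.sqrt (t e) ^+ 2 = 1 by near: e.
  split=> //.
  + rewrite /Bt' !trmx_mul !trmxK (is_diag_mx_tr _ _ (Lt e)) ?mulmxA//.
    by near: e.
  + have [] := plane_rotation_conj (k e) _ _ _ (x e) Dd cse.
    rewrite -LtDx -/(rot e) sqr_sqrtr// tE => ulE drE.
    (* All the block-diagonal factors are gathered outside the rotated spectrum, so the diagonal of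
       [Bt' e] depends only on its blocks [M e] and [d2]. *)
    have -> : Bt' e = block_mx (H2 e *m Q *m H1 e) 0 0 1%:M
        *m (rot e *m Lt e *m (rot e)^T)
        *m (block_mx (H2 e *m Q *m H1 e) 0 0 1%:M)^T.
      have -> : block_mx (H2 e *m Q *m H1 e) 0 0 1%:M =
          G2 e *m block_mx Q 0 0 1%:M *m block_mx (H1 e) 0 0 1%:M.
        by rewrite /G2 !mulmx_block !(mulmx0, mul0mx, mulmx1, addr0, add0r).
      by rewrite /Bt' /G1 !trmx_mul !mulmxA.
    rewrite -[rot e *m _ *m _]submxK ulE drE tr_block_mx !trmx0 trmx1.
    rewrite !mulmx_block !(mulmx0, mul0mx, mulmx1, mul1mx, addr0, add0r).
    rewrite !diag_of_block -Bt_diag BtQ !trmx_mul !mulmxA /delta.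
    by rewrite subKr.
  + apply: orthogonal_mxM; first exact: orthogonal_mx_block1.
    exact: plane_rotation_orthogonal.
  + exact: orthogonal_mx_block1.
- move/bigO_sqrP: H1_O => [C C0 H1_C].
  (* [C] bounds the [H1] part, while the rotation contributes [4 * t e] with
     [t e <= K * e / (gap / 2)]. *)
  apply/bigO_sqrP; exists (2 * (C + 4 * (K / (gap / 2)))).
    by rewrite mulr_gt0// addr_gt0// mulr_gt0// divr_gt0// divr_gt0.
  near=> e; have [//|_ t0 tK _] := near t_spec e.
  have e0 : 0 < e by near: e.
  have cse : Num.sqrt (1 - t e) ^+ 2 + Num.sqrt (t e) ^+ 2 = 1 by near: e.
  (* In this splitting the right factor [rot e] is orthogonal and drops out of the norm. *)
  have -> : G1 e - 1%:M =
      (block_mx (H1 e) 0 0 1%:M - 1%:M) *m rot e + (rot e - 1%:M).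
    by rewrite mulmxBl mul1mx addrA subrK.
  apply: le_trans (frobenius_norm_sqrD _ _ _ _) _.
  rewrite frobenius_norm_sqr_mulmx_orthogonal; last first.
    exact: plane_rotation_orthogonal.
  rewrite frobenius_norm_sqr_block1_sub1 -mulrA ler_pM2l// mulrDl lerD//.
    by near: e.
  apply: le_trans (frobenius_norm_sqr_plane_rotation _ _ _ _ cse) _ => //.
  by rewrite !sqr_sqrtr ?(ltW e0)// -mulrA ler_pM2l// mulrAC.
- move/bigO_sqrP: H2_O => [C C0 H2_C].
  apply/bigO_sqrP; exists C => //.
  near=> e; rewrite frobenius_norm_sqr_block1_sub1; near: e; exact: H2_C.
Unshelve. all: by end_near. Qed.
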